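(* Let $(A,B)$ be a Katsura pair with $B\in M_N(\{0,1\})$ such that the KEP-action $(G_B,E_A)$ is regular. Then there is a continuous injection $\zeta:\mathcal{J}_{G_B,E_A}\to\mathbb{C}$.
   Context: Katsura pair: $N\in\mathbb{N}$, $A\in M_N(\mathbb{N})$ (nonnegative integers), $B\in M_N(\mathbb{Z})$ with $A_{ij}=0\Rightarrow B_{ij}=0$. Graph $E_A$: vertices $\{1,\dots,N\}$, edges $e_{i,j,m}$ ($0\le m<A_{ij}$) with $r=i$, $s=j$; finite paths $\mu_1\cdots\mu_n$ with $s(\mu_i)=r(\mu_{i+1})$; $E_A^{-\infty}$ left-infinite paths $\cdots\mu_{-2}\mu_{-1}$ with product topology, shift $\sigma$ deleting $\mu_{-1}$. The group bundle $\mathbb{Z}\times E_A^0$ (elements $a_i^k$) acts by $a_i^k\cdot e_{i,j,m}=e_{i,j,\hat m}$, $a_i^k|_{e_{i,j,m}}=a_j^{\hat k}$ with $kB_{ij}+m=\hat kA_{ij}+\hat m$, $0\le\hat m<A_{ij}$, extended recursively to paths by $g\cdot(e\nu)=(g\cdot e)(g|_e\cdot\nu)$; $G_B$ is the quotient by the elements acting trivially, and $(G_B,E_A)$ is the KEP-action. Regular: for every $g\in G_B$ there is $K$ such that $g\cdot\mu=\mu$, $|\mu|\ge K$ imply $g|_\mu$ is the unit at $s(\mu)$. Limit space: $\mu\sim_{ae}\nu$ iff there are a finite $F\subseteq G_B$ and $(g_n)_{n<0}\subseteq F$ with $d(g_n)=r(\mu_n)$ and $g_n\cdot\mu_n\cdots\mu_{-1}=\nu_n\cdots\nu_{-1}$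 for all $n<0$; $\mathcal{J}_{G_B,E_A}=E_A^{-\infty}/\sim_{ae}$ with quotient topology. *)

(* Defs.v *)
From HB Require Import structures.
From mathcomp Require Import all_boot all_order all_algebra.
From mathcomp Require Import complex.
From mathcomp Require Import Rstruct.
Set Implicit Arguments. Unset Strict Implicit. Unset Printing Implicit Defensive.
Import Order.TTheory GRing.Theory Num.Theory.
Local Open Scope ring_scope.

Definition CC : Type := complex Rdefinitions.R.

(** Edges of the graph E_A: e_{i,j,m} is encoded as ((i, j), m), with
    range r = i, source s = j, and validity m < A i j. *)
Definition edge (N : nat) : Type := ('I_N * 'I_N * nat)%type.
Definition rg {N} (e : edge N) : 'I_N := e.1.1.
Definition sc {N} (e : edge N) : 'I_N := e.1.2.
Definition valid_edge {N} (A : 'M[nat]_N) (e : edge N) : bool :=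
  (e.2 < A (rg e) (sc e))%N.

Definition katsura_pair (N : nat) (A : 'M[nat]_N) (B : 'M[int]_N) : Prop :=
  forall i j, A i j = 0%N -> B i j = 0.

(** Action of a_i^k (i = r(e)) on an edge e = e_{i,j,m}: returns
    (e_{i,j,mhat}, khat) where k*B_ij + m = khat*A_ij + mhat, 0 <= mhat < A_ij.
    The result a_j^khat is the restriction a_i^k|_e. *)
Definition act_edge {N} (A : 'M[nat]_N) (B : 'M[int]_N) (k : int) (e : edge N)
  : edge N * int :=
  let a : int := (A (rg e) (sc e))%:Z in
  let t : int := k * B (rg e) (sc e) + (e.2)%:Z in
  ((e.1, `|(t %% a)%Z|%N), (t %/ a)%Z).

(** Recursive extension to finite paths mu_1 ... mu_n (listed left to right):
    g.(e nu) = (g.e)(g|_e . nu), g|_(e nu) = (g|_e)|_nu.  Returns the image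
    path together with the integer k' of the restriction a_{s(mu)}^{k'}. *)
Fixpoint act_path {N} (A : 'M[nat]_N) (B : 'M[int]_N) (k : int) (p : seq (edge N))
  : seq (edge N) * int :=
  match p with
  | [::] => ([::], k)
  | e :: p' =>
      let ek := act_edge A B k e in
      let rest := act_path A B ek.2 p' in
      (ek.1 :: rest.1, rest.2)
  end.

Fixpoint fpath {N} (A : 'M[nat]_N) (i : 'I_N) (p : seq (edge N)) : bool :=
  match p with
  | [::] => true
  | e :: p' => [&& rg e == i, valid_edge A e & fpath A (sc e) p']
  end.

Fixpoint fsource {N} (i : 'I_N) (p : seq (edge N)) : 'I_N :=
  match p with
  | [::] => i
  | e :: p' => fsource (sc e) p'
  end.

(** Equality in G_B (quotient of Z x E^0 by the elements acting trivially):
    a_i^k and a_i^k' are identified iff they act identically on all finite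
    paths with range i. *)
Definition gequiv {N} (A : 'M[nat]_N) (B : 'M[int]_N) (i : 'I_N) (k k' : int) : Prop :=
  forall p, fpath A i p -> (act_path A B k p).1 = (act_path A B k' p).1.

Definition regular_KEP {N} (A : 'M[nat]_N) (B : 'M[int]_N) : Prop :=
  forall (i : 'I_N) (k : int), exists K : nat,
    forall p, fpath A i p -> (K <= size p)%N ->
      (act_path A B k p).1 = p ->
      gequiv A B (fsource i p) (act_path A B k p).2 0.

(** Left-infinite paths ... mu_{-2} mu_{-1}: encoded as x : nat -> edge with
    x n = mu_{-(n+1)}; composability s(mu_{-(n+2)}) = r(mu_{-(n+1)}). *)
Definition linf_path {N} (A : 'M[nat]_N) (x : nat -> edge N) : Prop :=
  forall n, valid_edge A (x n) /\ sc (x n.+1) = rg (x n).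

Definition ltail {N} (x : nat -> edge N) (n : nat) : seq (edge N) :=
  rev (mkseq x n.+1).

(** Asymptotic equivalence ~_ae: there are a finite F (given by a finite list
    of representatives a_i^k of elements of G_B) and g_n in F with
    d(g_n) = r(mu_n) and g_n . mu_n ... mu_{-1} = nu_n ... nu_{-1}. *)
Definition ae_equiv {N} (A : 'M[nat]_N) (B : 'M[int]_N) (x y : nat -> edge N) : Prop :=
  exists (F : seq ('I_N * int)) (g : nat -> 'I_N * int),
    forall n, [/\ g n \in F, (g n).1 = rg (x n) &
                  (act_path A B (g n).2 (ltail x n)).1 = ltail y n].

(** Continuity on E_A^{-infty} (product topology of discrete edge sets):
    f is continuous at every left-infinite x. *)
Definition linf_continuous {N} (A : 'M[nat]_N) (f : (nat -> edge N) -> CC) : Prop :=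
  forall x, linf_path A x ->
  forall eps : Rdefinitions.R, 0 < eps -> exists K : nat,
    forall y, linf_path A y -> (forall n, (n < K)%N -> y n = x n) ->
      `|f y - f x| < (eps%:C)%C.

(** A continuous injection zeta : J_{G_B,E_A} = E_A^{-infty}/~_ae -> C,
    given (via the universal property of the quotient topology) by its lift
    f = zeta o q : E_A^{-infty} -> C, continuous, with
    f x = f y <-> x ~_ae y (well defined and injective on the quotient). *)
Definition limit_space_embeds_in_C {N} (A : 'M[nat]_N) (B : 'M[int]_N) : Prop :=
  exists f : (nat -> edge N) -> CC,
    linf_continuous A f /\
    (forall x y, linf_path A x -> linf_path A y ->
       (f x = f y <-> ae_equiv A B x y)).

(* Main.v *)
(** Asymptotic equivalence preserves the sequence of pairs (range, source), and
a carry travels from left to right, dying at every edge with B = 0.  Read a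
left-infinite path from the right.  Up to the first edge with B = 0 the numbers
m are the digits of an angle in R/Z (most significant digit first) and an
integral carry is exactly what identifies two expansions of the same angle; all
edges to the right of an edge with B = 0 are uniquely determined.  So a path is
sent to a point of a circle whose radius is a Cantor code of its (range, source)
sequence, and an edge with B = 0 replaces that point by a tiny copy of the whole
picture centred at it, in which the rest of the path is read.  An edge with
A = B = 1 carries no digit and passes the carry on, so it would not shrink
anything; before the first digit of a circle it is treated like an edge with
B = 0, and regularity bounds the length of the runs of such edges after it. *)

Require Import Defs.
From HB Require Import structures.
From mathcomp Require Import all_boot all_order all_algebra.
From mathcomp Require Import complex.
From mathcomp Require Import boolp classical_sets reals Rstruct ring lra zify.
Set Implicit Arguments. Unset Strict Implicit. Unset Printing Implicit Defensive.
Import Order.TTheory GRing.Theory Num.Theory.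
Local Open Scope ring_scope.

(** * The unit circle of the l1 norm *)

Section Loop.
Variable R : realFieldType.
Definition nrm (w : R^o * R^o) : R := `|w.1| + `|w.2|.

(** A piecewise affine substitute for [exp(2 pi i t)]; its distances are accessible to linear
    arithmetic. *)
Definition loop (t : R) : R^o * R^o :=
  if t <= 4^-1 then (1 - 4 * t, 4 * t)
  else if t <= 2^-1 then (1 - 4 * t, 2 - 4 * t)
  else if t <= 3 / 4 then (4 * t - 3, 2 - 4 * t)
  else (4 * t - 3, 4 * t - 4).

Variant loop_spec (t : R) : R^o * R^o -> Prop :=
 | LoopSpec1 of 4 * t <= 1 : loop_spec t (1 - 4 * t, 4 * t)
 | LoopSpec2 of 1 <= 4 * t & 4 * t <= 2 : loop_spec t (1 - 4 * t, 2 - 4 * t)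
 | LoopSpec3 of 2 <= 4 * t & 4 * t <= 3 : loop_spec t (4 * t - 3, 2 - 4 * t)
 | LoopSpec4 of 3 <= 4 * t : loop_spec t (4 * t - 3, 4 * t - 4).

Lemma loopP t : loop_spec t (loop t).
Proof.
rewrite /loop; case: (lerP t 4^-1) => ?; first by constructor; lra.
case: (lerP t 2^-1) => ?; first by constructor; lra.
by case: (lerP t (3/4)) => ?; constructor; lra.
Qed.

Variant norm_spec (x : R) : R -> Prop :=
 | NormSpec1 of 0 <= x : norm_spec x x
 | NormSpec2 of x <= 0 : norm_spec x (- x).
Lemma normP x : norm_spec x `|x|.
Proof. by case: (ger0P x) => h; constructor => //; exact: ltW. Qed.

Lemma nrm_loop t : 0 <= t -> t <= 1 -> nrm (loop t) = 1.
Proof.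
move=> t0 t1; rewrite /nrm; case: loopP => /= *; do 2 (case: normP => ?); lra.
Qed.

(** [loop] is bi-Lipschitz for the distance of R/Z. Both coordinates have slope 4 up to sign, whence
    the 8; antipodal points, at distance 2, show that the 4 is optimal. *)
Lemma loop_dist_le t t' : 0 <= t -> t <= t' -> t' <= 1 ->
  [/\ nrm (loop t' - loop t) <= 8 * (t' - t),
      nrm (loop t' - loop t) <= 8 * (1 - (t' - t)) &
      4 * Num.min (t' - t) (1 - (t' - t)) <= nrm (loop t' - loop t)].
Proof.
move=> t0 tt t1.
(* The minimum is replaced by an [m] below both arguments, which keeps every case linear. *)
have : Num.min (t' - t) (1 - (t' - t)) <= 1 - (t' - t) by rewrite ge_min lexx orbT.
have : Num.min (t' - t) (1 - (t' - t)) <= t' - t by rewrite ge_min lexx.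
move: (Num.min _ _) => m m1 m2.
rewrite /nrm; case: (loopP t') => [h1|h1 h2|h1 h2|h1]; case: (loopP t) => [h1'|h1' h2'|h1' h2'|h1'] /=;
 try (by exfalso; clear m1 m2; lra).
all: do 2 (case: normP => ?); split; lra.
Qed.

Lemma nrmD u v : nrm (u + v) <= nrm u + nrm v.
Proof. by rewrite /nrm /= addrACA; exact: lerD (ler_normD _ _) (ler_normD _ _). Qed.

Lemma nrmN u : nrm (- u) = nrm u.
Proof. by rewrite /nrm /= !normrN. Qed.

Lemma nrmZ a u : nrm (a *: u) = `|a| * nrm u.
Proof. by rewrite /nrm /= !normrM mulrDr. Qed.

Lemma nrm_ge0 u : 0 <= nrm u.
Proof. exact: addr_ge0. Qed.

Lemma nrmB u v : nrm (u - v) = nrm (v - u).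
Proof. by rewrite -nrmN opprB. Qed.

Lemma nrm_dist u v w : nrm (u - w) <= nrm (u - v) + nrm (v - w).
Proof. by rewrite -{1}(subrK v u) -addrA nrmD. Qed.

Lemma loop_dist t t' : 0 <= t <= 1 -> 0 <= t' <= 1 ->
  [/\ nrm (loop t - loop t') <= 8 * `|t - t'|,
      nrm (loop t - loop t') <= 8 * (1 - `|t - t'|) &
      4 * Num.min `|t - t'| (1 - `|t - t'|) <= nrm (loop t - loop t')].
Proof.
move=> /andP[t0 t1] /andP[t0' t1']; case: (lerP t t') => [|/ltW] tt'.
  by rewrite nrmB; exact: loop_dist_le.
exact: loop_dist_le.
Qed.
End Loop.

(** * Pictures *)

(** The circle (for the l1 norm) of radius [scl * rad] around [org] is where the
current block of digits is drawn; [num / den] is the angle read so far, and the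
final radius lies in [scl * [rad, rad + win]]. *)
Record picture (R : realFieldType) := Picture
  { org : R^o * R^o; scl : R; rad : R; win : R; den : nat; num : nat }.

Section Pictures.
Variables (R : realFieldType) (N : nat) (A : 'M[nat]_N) (B : 'M[int]_N).
Variables (code : edge N -> nat) (b : nat).
Hypothesis code_inj : injective code.
Hypothesis code_gt0 : forall e, (0 < code e)%N.
Hypothesis b_code : forall e, valid_edge A e -> ((code e).*2.+1 <= b)%N.
Hypothesis b_deg : forall e, valid_edge A e -> (A (rg e) (sc e) <= b)%N.

Implicit Types (s t : picture R) (e : edge N) (es : seq (edge N)).

Definition deg e : nat := A (rg e) (sc e).
(** The second test says that no digit was read on this circle and that [e] carries none; the
    congruence modulo [den] that is forgotten there is vacuous. *)
Definition is_break s e : bool :=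
  (B (rg e) (sc e) == 0) || (den s * deg e == 1)%N.
(* At a break the digit is part of the label, since the next circle starts afresh
   there; otherwise it belongs to the angle. *)
Definition label s e : nat := code (if is_break s e then e else (e.1, 0%N)).
Definition win_next s : R := win s / b%:R.
(** Of [b] equal pieces of the window, counted from 0, label [l] gets piece [2 l]; the odd pieces
    are gaps, as in a Cantor set. *)
Definition rad_next s e : R := rad s + 2 * (label s e)%:R * win_next s.
(* Small against both the spacing [win_next] of the radii and the spacing
   [1 / den] of the angles. *)
Definition shrink s : R := win_next s / (36 * (den s)%:R).
Definition angle s : R := (num s)%:R / (den s)%:R.

Definition step s e : picture R :=
  if is_break s e then
    Picture (org s + (scl s * rad_next s e) *: loop (angle s))
            (scl s * shrink s) 1 1 1 0
  else
    Picture (org s) (scl s) (rad_next s e) (win_next s)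
            (den s * deg e) (num s * deg e + e.2).

Definition run s es : picture R := foldl step s es.
Definition ctr s : R^o * R^o := org s + (scl s * rad s) *: loop (angle s).
(* Bounds the distance from [ctr s] to the centre of any continuation of [s]. *)
Definition err s : R := scl s * (win s + 16 / (den s)%:R).

(** The invariant of reading valid edges. All radii stay in [1, 2], and [win * den <= 1] keeps the
    radial uncertainty below the angular one. *)
Definition good s : Prop :=
  [/\ 0 < scl s, 1 <= rad s, 0 < win s & rad s + win s <= 2] /\
  [/\ win s * (den s)%:R <= 1, (0 < den s)%N & (num s < den s)%N].

Lemma valid_label s e : valid_edge A e -> ((label s e).*2.+1 <= b)%N.
Proof.
move=> ve; rewrite /label; case: ifP => _; apply: b_code => //.
exact: leq_ltn_trans ve.
Qed.

Lemma label_gt0 s e : (0 < label s e)%N.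
Proof. exact: code_gt0. Qed.

Lemma valid_b_ge3 e : valid_edge A e -> (3 <= b)%N.
Proof.
move=> ve; have := b_code ve; have := code_gt0 e; lia.
Qed.

Lemma win_next_gt0 s e : good s -> valid_edge A e -> 0 < win_next s.
Proof.
move=> [[_ _ w0 _] _] /valid_b_ge3 b3; rewrite divr_gt0 // ltr0n; lia.
Qed.

Lemma label_win s e : good s -> valid_edge A e ->
  (2 * (label s e)%:R + 1) * win_next s <= win s.
Proof.
move=> gs ve; have w1 := win_next_gt0 gs ve.
have b3 := valid_b_ge3 ve.
have b0 : (0 : R) < b%:R by rewrite ltr0n; lia.
have -> : win s = b%:R * win_next s by rewrite /win_next mulrC divfK ?gt_eqF.
rewrite ler_pM2r //; have := valid_label s ve.
rewrite -(ler_nat R) -addn1 -muln2 natrD natrM; lra.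
Qed.

Lemma rad_le_next s e : good s -> valid_edge A e -> rad s <= rad_next s e.
Proof.
move=> gs ve; rewrite /rad_next lerDl mulr_ge0 //; first by rewrite mulr_ge0.
by rewrite ltW // (win_next_gt0 gs ve).
Qed.

Lemma win_next_den s e : good s -> valid_edge A e ->
  win_next s * (den s)%:R * 3 <= 1.
Proof.
move=> gs ve; have [[_ _ w0 _] [wd _ _]] := gs.
have := label_win gs ve; have := win_next_gt0 gs ve.
have := label_gt0 s e; rewrite -(ler_nat R) => c0 w1 lw.
apply: le_trans wd; rewrite mulrAC ler_wpM2r ?ler0n //.
apply: le_trans lw; rewrite [leLHS]mulrC ler_pM2r //.
by lra.
Qed.

Lemma shrink_gt0 s e : good s -> valid_edge A e -> 0 < shrink s.
Proof.
move=> gs ve; have [_ [_ d0 _]] := gs.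
by rewrite divr_gt0 ?(win_next_gt0 gs ve) // mulr_gt0 // ltr0n.
Qed.

Lemma shrink_win s e : good s -> valid_edge A e -> 36 * shrink s <= win_next s.
Proof.
move=> gs ve; have [_ [_ d0 _]] := gs.
have d1 : (1 : R) <= (den s)%:R by rewrite ler1n.
have w1 := win_next_gt0 gs ve; have s0 := shrink_gt0 gs ve.
have -> : win_next s = 36 * shrink s * (den s)%:R.
  by rewrite /shrink; field; rewrite gt_eqF // ltr0n.
by rewrite ler_peMr // mulr_ge0 // ltW.
Qed.

Lemma good_step s e : good s -> valid_edge A e -> good (step s e).
Proof.
move=> gs ve; have [[s0 r1 w0 rw] [wd d0 nd]] := gs.
have lw := label_win gs ve; have w1 := win_next_gt0 gs ve.
have sh := shrink_gt0 gs ve.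
rewrite /step; case: ifP => _.
  by split; split; rewrite //= ?mul1r // mulr_gt0.
have e0 : (0 < deg e)%N by exact: leq_ltn_trans ve.
have rw' : rad_next s e + win_next s <= 2 by rewrite /rad_next; lra.
have r1' : 1 <= rad_next s e.
  exact: le_trans r1 (rad_le_next gs ve).
split; split => //=.
(* The window shrinks by [b] while [den] grows by [deg e <= b], so [win * den] does not grow. *)
- rewrite /win_next natrM.
  have b0 : (0 : R) < b%:R by rewrite ltr0n; have := valid_b_ge3 ve; lia.
  rewrite mulrAC ler_pdivrMr // mul1r.
  have hb : (deg e)%:R <= b%:R :> R by rewrite ler_nat; exact: b_deg.
  apply: le_trans hb; rewrite mulrA ler_piMl //.
- by rewrite muln_gt0 d0.
- have ve' : (e.2 < deg e)%N by [].
  by rewrite (leq_trans (_ : _ < (num s).+1 * deg e)%N) ?leq_mul2r ?nd ?orbT //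
     mulSn addnC ltn_add2r.
Qed.

Lemma good_run s es : good s -> all (valid_edge A) es -> good (run s es).
Proof.
elim: es s => [|e es IH] s //= gs /andP[ve ves].
by apply: IH => //; exact: good_step.
Qed.

Lemma angle01 s : good s -> 0 <= angle s <= 1.
Proof.
move=> [_ [_ d0 nd]]; rewrite /angle divr_ge0 //= ler_pdivrMr ?ltr0n // mul1r ler_nat.
exact: ltnW.
Qed.

Lemma nrm_loop_angle s : good s -> nrm (loop (angle s)) = 1.
Proof. by move=> /angle01 /andP[a0 a1]; exact: nrm_loop. Qed.

Lemma err_ge0 s : good s -> 0 <= err s.
Proof.
move=> [[s0 _ w0 _] _]; rewrite mulr_ge0 ?(ltW s0) // addr_ge0 ?(ltW w0) //.
exact: divr_ge0.
Qed.

Lemma err_le s : good s -> err s <= 17 * (scl s / (den s)%:R).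
Proof.
move=> [[s0 _ _ _] [wd d0 _]].
have d0' : (0 : R) < (den s)%:R by rewrite ltr0n.
rewrite /err mulrCA ler_wpM2l ?(ltW s0) //.
have : win s <= 1 / (den s)%:R by rewrite ler_pdivlMr.
rewrite div1r; lra.
Qed.

(** This nests the balls of radius [err] around [ctr]: the radial move is paid for by [win], the
    rotation by [16 / den]. *)
Lemma ctr_step s e : good s -> valid_edge A e ->
  nrm (ctr (step s e) - ctr s) + err (step s e) <= err s.
Proof.
move=> gs ve; have gs' := good_step gs ve.
have [[s0 r1 w0 rw] [wd d0 nd]] := gs.
have lw := label_win gs ve; have w1 := win_next_gt0 gs ve.
have sh := shrink_gt0 gs ve; have shw := shrink_win gs ve.
have e0 : (0 < deg e)%N by exact: leq_ltn_trans ve.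
have rr : 0 <= rad_next s e - rad s by rewrite subr_ge0; exact: rad_le_next.
have d0' : (0 : R) < (den s)%:R by rewrite ltr0n.
have a0' : (0 : R) < (deg e)%:R by rewrite ltr0n.
move: gs' (angle01 gs) (nrm_loop_angle gs).
rewrite /step; case: ifP => _ gs' ang nl.
  (* At a break the centre moves outwards and then by the radius of the tiny circle; together with
     the new error this costs [18 * shrink <= win_next / 2] beyond the radial move. *)
  have -> : ctr (Picture (org s + (scl s * rad_next s e) *: loop (angle s))
     (scl s * shrink s) 1 1 1 0) - ctr s =
     scl s *: ((rad_next s e - rad s) *: loop (angle s)
               + shrink s *: loop (angle (Picture (org s) 1 1 1 1 0))).
    rewrite /ctr /= /angle /= mulr1 scalerDr !scalerA mulrBr scalerBl.
    by rewrite opprD addrAC addrACA subrr add0r.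
  have -> : err (Picture (org s + (scl s * rad_next s e) *: loop (angle s))
     (scl s * shrink s) 1 1 1 0) = scl s * (shrink s * 17).
    by rewrite /err /= mulrA; congr (_ * _); lra.
  rewrite nrmZ (gtr0_norm s0) -mulrDr /err ler_wpM2l ?(ltW s0) //.
  have := nrmD ((rad_next s e - rad s) *: loop (angle s))
               (shrink s *: loop (angle (Picture (org s) 1 1 1 1 0))).
  rewrite !nrmZ nl mulr1 (ger0_norm rr) (gtr0_norm sh).
  rewrite nrm_loop /angle /= ?mul0r //.
  have : 0 <= 16 / (den s)%:R :> R by rewrite divr_ge0.
  rewrite /rad_next; lra.
set s' := Picture _ _ _ _ _ _ in gs' *.
(* A radial move at the new angle plus a rotation at the old radius. *)
have -> : ctr s' - ctr s = scl s *: ((rad_next s e - rad s) *: loop (angle s')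
               + rad s *: (loop (angle s') - loop (angle s))).
  rewrite /ctr /= scalerBl scalerBr addrA subrK scalerBr !scalerA.
  by rewrite opprD addrACA subrr add0r.
rewrite nrmZ (gtr0_norm s0) /err -mulrDr ler_wpM2l ?(ltW s0) //=.
have ang' := angle01 gs'.
have [ld _ _] := loop_dist ang' ang.
have := nrmD ((rad_next s e - rad s) *: loop (angle s'))
             (rad s *: (loop (angle s') - loop (angle s))).
rewrite !nrmZ (nrm_loop_angle gs') mulr1 (ger0_norm rr) (gtr0_norm (lt_le_trans ltr01 r1)).
have dif : angle s' - angle s = e.2%:R / ((den s)%:R * (deg e)%:R).
  by rewrite /angle /= natrD !natrM; field; rewrite !gt_eqF.
(* The 16 in [err] is the bound 2 on the radius times the Lipschitz constant 8. *)
have : rad s * nrm (loop (angle s') - loop (angle s)) <=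
       16 * (e.2%:R / ((den s)%:R * (deg e)%:R)).
  move: ld; rewrite dif ger0_norm; last by rewrite divr_ge0 // mulr_ge0.
  have := nrm_ge0 (loop (angle s') - loop (angle s)).
  move: (nrm _) => n; move: (_ / _) => q n0 nq.
  have : rad s * n <= 2 * n by rewrite ler_wpM2r //; lra.
  lra.
(* The digit is at most [deg e - 1], which leaves room for the angular error of the next picture. *)
have : e.2%:R / ((den s)%:R * (deg e)%:R) + 1 / ((den s)%:R * (deg e)%:R)
  <= 1 / (den s)%:R :> R.
  rewrite -mulrDl ler_pdivrMr ?mulr_gt0 // mul1r mulKf ?gt_eqF //.
  by rewrite natr1 ler_nat.
rewrite natrM /rad_next !div1r.
move: (nrm _) (nrm _) (_ / _) => *; lra.
Qed.

Lemma ctr_run s es : good s -> all (valid_edge A) es ->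
  nrm (ctr (run s es) - ctr s) + err (run s es) <= err s.
Proof.
elim: es s => [|e es IH] s /= gs.
  by move=> _; rewrite subrr /nrm /= normr0 !add0r.
move=> /andP[ve ves]; have /IH/(_ ves) h := good_step gs ve.
apply: le_trans (ctr_step gs ve); rewrite addrC.
have := nrm_dist (ctr (run (step s e) es)) (ctr (step s e)) (ctr s).
move: (nrm _) (nrm _) (nrm _) h => n1 n2 n3 h; rewrite -/(run _ _) in h *; lra.
Qed.

Lemma nrm_ctr s : good s -> nrm (ctr s - org s) = scl s * rad s.
Proof.
move=> gs; have [[s0 r1 _ _] _] := gs.
rewrite /ctr [org s + _]addrC addrK nrmZ (nrm_loop_angle gs) mulr1 ger0_norm //.
by rewrite mulr_ge0 ?(ltW s0) // (le_trans _ r1).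
Qed.

(** The tiny circle has radius [shrink], and the error around its starting point is
    [17 * shrink]. *)
Lemma ctr_run_break s e es : good s -> valid_edge A e -> all (valid_edge A) es ->
  is_break s e ->
  nrm (ctr (run s (e :: es)) - (org s + (scl s * rad_next s e) *: loop (angle s)))
  <= scl s * (18 * shrink s).
Proof.
move=> gs ve ves br; have gs' := good_step gs ve.
have [[s0 _ _ _] _] := gs; have sh := shrink_gt0 gs ve.
have := ctr_run gs' ves; have := err_ge0 (good_run gs' ves).
have := nrm_dist (ctr (run (step s e) es)) (ctr (step s e)) (org (step s e)).
rewrite (nrm_ctr gs') [run s _]/= -/(run _ _); move: (ctr (run _ _)) (err (run _ _)) => w q.
have -> : org (step s e) = org s + (scl s * rad_next s e) *: loop (angle s).
  by rewrite /step br.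
have -> : scl (step s e) * rad (step s e) = scl s * shrink s.
  by rewrite /step br /= mulr1.
have -> : err (step s e) = scl s * shrink s * 17.
  by rewrite /err /step br /=; congr (_ * _); lra.
rewrite (mulrCA (scl s) 18).
move: (nrm _) (nrm _) (scl s * shrink s) => *; lra.
Qed.

Lemma ctr_run_break_window s e es : good s -> valid_edge A e -> all (valid_edge A) es ->
  is_break s e ->
  (scl s * rad_next s e - scl s * (win_next s / 2) <= nrm (ctr (run s (e :: es)) - org s)
   <= scl s * rad_next s e + scl s * (win_next s / 2))%R.
Proof.
move=> gs ve ves br; have := ctr_run_break gs ve ves br.
have [[s0 r1 _ _] _] := gs.
have := shrink_win gs ve; rewrite -(ler_pM2l s0) => sw.
have r0 : 0 <= rad_next s e by rewrite (le_trans _ (rad_le_next gs ve)) // (le_trans _ r1).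
set c := ctr _; set l := (scl s * rad_next s e) *: loop (angle s) => h.
have nl : nrm l = scl s * rad_next s e.
  by rewrite nrmZ (nrm_loop_angle gs) mulr1 ger0_norm // mulr_ge0 // ltW.
rewrite -nl; have := nrm_dist (c - org s) l 0; have := nrm_dist l (c - org s) 0.
rewrite !subr0 (nrmB l); rewrite opprD addrA in h.
move: (nrm _) (nrm _) (nrm _) h => n1 n2 n3 h a1 a2; apply/andP; split; lra.
Qed.

Lemma step_continue s e : ~~ is_break s e ->
  [/\ org (step s e) = org s, scl (step s e) = scl s,
      rad (step s e) = rad_next s e & win (step s e) = win_next s].
Proof. by rewrite /step => /negbTE ->. Qed.

(** At a break the tiny copy may stick out by half of [win_next]; as labels are positive, it does
    not fall below the inner radius. *)
Lemma ctr_run_window s es : good s -> all (valid_edge A) es ->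
  scl s * rad s <= nrm (ctr (run s es) - org s) <= scl s * (rad s + win s).
Proof.
elim: es s => [|e es IH] s gs.
  move=> _; have [[s0 r1 w0 _] _] := gs.
  by rewrite nrm_ctr // lexx ler_pM2l // lerDl ltW.
case/andP=> ve ves; have [[s0 r1 w0 _] _] := gs.
have w1 := win_next_gt0 gs ve; have lw := label_win gs ve.
have c1 : 1 <= (label s e)%:R :> R by rewrite ler1n label_gt0.
have cw : win_next s <= (label s e)%:R * win_next s by rewrite ler_peMl // ltW.
case: (boolP (is_break s e)) => br.
  have /andP[h1 h2] := ctr_run_break_window gs ve ves br.
  apply/andP; split.
    apply: le_trans h1; rewrite -mulrBr ler_pM2l // /rad_next; lra.
  apply: (le_trans h2); rewrite -mulrDr ler_pM2l // /rad_next; lra.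
have := IH _ (good_step gs ve) ves.
rewrite [run s _]/= -/(run _ _).
have [-> -> -> ->] := step_continue br.
move=> /andP[h1 h2].
apply/andP; split.
  by apply: le_trans h1; rewrite ler_pM2l //; exact: rad_le_next.
apply: (le_trans h2); rewrite ler_pM2l // /rad_next; lra.
Qed.

(** A tiny copy exceeds its radius by half a piece on either side, a digit fills its own piece. As
    labels are two pieces apart, half a piece remains between different labels. *)
Lemma ctr_run_cons s e es : good s -> valid_edge A e -> all (valid_edge A) es ->
  scl s * rad_next s e - scl s * (win_next s / 2) <= nrm (ctr (run s (e :: es)) - org s)
  <= scl s * rad_next s e + scl s * win_next s.
Proof.
move=> gs ve ves; have [[s0 r1 w0 _] _] := gs; have w1 := win_next_gt0 gs ve.
have w2 : 0 < scl s * (win_next s / 2) by rewrite mulr_gt0 // divr_gt0.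
have w3 : scl s * win_next s = scl s * (win_next s / 2) * 2.
  by rewrite -mulrA divfK // pnatr_eq0.
case: (boolP (is_break s e)) => br.
  have /andP[h1 h2] := ctr_run_break_window gs ve ves br.
  rewrite h1 /=; apply: (le_trans h2); lra.
have := ctr_run_window (good_step gs ve) ves.
rewrite [run s _]/= -/(run _ _).
have [-> -> -> ->] := step_continue br.
move=> /andP[h1 h2]; rewrite -mulrDr h2 andbT; apply: le_trans h1; lra.
Qed.

(** * Two paths read side by side: pictures that may differ only in the angle *)

Definition aligned s t : Prop :=
  [/\ org s = org t, scl s = scl t, rad s = rad t, win s = win t & den s = den t].

Lemma aligned_sym s t : aligned s t -> aligned t s.
Proof. by case=> *; split. Qed.

Lemma aligned_break s t e e' : aligned s t -> e.1 = e'.1 ->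
  is_break s e = is_break t e'.
Proof.
by move=> [_ _ _ _ d]; rewrite /is_break /deg /rg /sc => ->; rewrite d.
Qed.

Lemma aligned_label s t e e' : aligned s t -> e.1 = e'.1 ->
  (is_break s e -> e = e') -> label s e = label t e'.
Proof.
move=> st ee; rewrite /label -(aligned_break st ee) ee.
by case: ifP => // _ ->.
Qed.

Lemma label_inj s t e e' : aligned s t -> label s e = label t e' ->
  e.1 = e'.1 /\ (is_break s e -> e = e').
Proof.
move=> st /code_inj h.
have ee : e.1 = e'.1 by move: h; do 2 case: ifP => _; case: (e) (e') => [? ?] [? ?] /= [].
split=> // br; move: h; by rewrite -(aligned_break st ee) br.
Qed.

(** At a break the angle enters the new origin, so the numerators must agree there. *)
Lemma aligned_step s t e e' : aligned s t -> e.1 = e'.1 ->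
  (is_break s e -> e = e' /\ num s = num t) -> aligned (step s e) (step t e').
Proof.
move=> st ee h.
have lab : label s e = label t e' by apply: aligned_label => // /h[].
have [o sc r w d] := st.
have wn : win_next s = win_next t by rewrite /win_next w.
have rn : rad_next s e = rad_next t e' by rewrite /rad_next r lab wn.
rewrite /step -(aligned_break st ee); case: ifP => br.
  by case: (h br) => _ n; rewrite /aligned /= /shrink /angle n d o sc rn wn.
by rewrite /aligned /= o sc rn wn /deg /rg /Defs.sc ee d.
Qed.

(** Different labels would put the two points at distances from the common origin that differ by at
    least half a piece, by [ctr_run_cons]. *)
Lemma label_close s t e e' es es' : aligned s t -> good s -> good t ->
  valid_edge A e -> valid_edge A e' -> all (valid_edge A) es -> all (valid_edge A) es' ->
  nrm (ctr (run s (e :: es)) - ctr (run t (e' :: es'))) < scl s * (win_next s / 2) ->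
  label s e = label t e'.
Proof.
wlog ltl : s t e e' es es' / (label s e < label t e')%N.
  move=> wl st gs gt ve ve' ves ves' h.
  case: (ltngtP (label s e) (label t e')) => // l; first exact: (wl s t e e' es es').
  apply/esym; apply: (wl t s e' e es' es) => //; first exact: aligned_sym.
  by rewrite nrmB; have [_ <- _ w _] := st; rewrite /win_next -w.
move=> st gs gt ve ve' ves ves' h; exfalso.
have /andP[_ up] := ctr_run_cons gs ve ves.
have /andP[low _] := ctr_run_cons gt ve' ves'.
have [o sc r w d] := st.
have wn : win_next s = win_next t by rewrite /win_next w.
have := nrm_dist (ctr (run t (e' :: es'))) (ctr (run s (e :: es))) (org t).
rewrite (nrmB (ctr (run t _)) (ctr (run s _))) -{2}o; move: low up h; rewrite -{1}sc; move: (nrm _) (nrm _) (nrm _) => n1 n2 n3.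
rewrite /rad_next -wn -r -sc; have w1 := win_next_gt0 gs ve; have [[s0 _ _ _] _] := gs.
have : scl s * win_next s * ((label s e)%:R + 1) <= scl s * win_next s * (label t e')%:R.
  by rewrite ler_pM2l ?(mulr_gt0 s0 w1) // natr1 ler_nat.
have : 0 < scl s * win_next s by exact: mulr_gt0.
set x := (label s e)%:R; set y := (label t e')%:R; set u := win_next s; set v := scl s.
have -> : v * (rad s + 2 * x * u) = v * rad s + 2 * (v * u * x) by ring.
have -> : v * (rad s + 2 * y * u) = v * rad s + 2 * (v * u * y) by ring.
have -> : v * (u / 2) = v * u / 2 by ring.
rewrite mulrDr mulr1; move: (v * u) => z; move: (z * x) (z * y) (v * rad s) => p1 p2 p3 z0 p12 low up.
by rewrite ltNge => /negP h tri; apply: h; lra.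
Qed.

Lemma angle_dist s t : aligned s t ->
  `|angle s - angle t| = (`|(num s)%:Z - (num t)%:Z|%N)%:R / (den s)%:R.
Proof.
move=> [_ _ _ _ d]; rewrite /angle -d -mulrBl normrM [X in _ * X]ger0_norm; last first.
  by rewrite invr_ge0.
congr (_ * _); have [le|/ltnW le] := leqP (num t) (num s).
  by rewrite -natrB // normr_nat; congr (_ %:R); lia.
by rewrite distrC -natrB // normr_nat; congr (_ %:R); lia.
Qed.

(** The two alternatives are whether the shorter arc avoids the angle 0 or passes through it. *)
Lemma angle_close s t q : aligned s t -> good s -> good t ->
  nrm (loop (angle s) - loop (angle t)) <= q / (den s)%:R ->
  4 * `|(num s)%:Z - (num t)%:Z|%N%:R <= q \/
  4 * (den s - `|(num s)%:Z - (num t)%:Z|)%N%:R <= q.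
Proof.
move=> st gs gt h; set d := `|_ - _|%N.
have [_ _ low] := loop_dist (angle01 gs) (angle01 gt).
have [_ [_ d0 ns]] := gs; have [_ [_ _]] := gt; have [_ _ _ _ <-] := st => nt.
have d0' : (0 : R) < (den s)%:R by rewrite ltr0n.
have dle : (d <= den s)%N by rewrite /d; move: ns nt; clear; lia.
have e1 : 1 - d%:R / (den s)%:R = (den s - d)%N%:R / (den s)%:R :> R.
  by rewrite natrB // mulrBl divff ?gt_eqF.
move: (le_trans low h); rewrite (angle_dist st) -/d e1.
rewrite minElt; case: ifP => _; rewrite mulrA ler_pM2r ?invr_gt0 // => ?; [by left|by right].
Qed.

Lemma num_close s t e es es' : aligned s t -> good s -> good t ->
  valid_edge A e -> all (valid_edge A) es -> all (valid_edge A) es' -> is_break s e ->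
  nrm (ctr (run s (e :: es)) - ctr (run t (e :: es'))) <= scl s / (den s)%:R ->
  num s = num t.
Proof.
move=> st gs gt ve ves ves' br h; have brt : is_break t e by rewrite -(aligned_break st (erefl _)).
have := ctr_run_break gt ve ves' brt; have := ctr_run_break gs ve ves br.
have [o sc r w d] := st; have [[s0 r1 _ _] [_ d0 ns]] := gs.
have lab : label s e = label t e by exact: aligned_label.
have wn : win_next s = win_next t by rewrite /win_next w.
have -> : rad_next t e = rad_next s e by rewrite /rad_next r lab wn.
have -> : shrink t = shrink s by rewrite /shrink d wn.
rewrite -o -sc; set l := _ *: loop (angle s); set l' := _ *: loop (angle t).
move=> h1 h2.
have := nrm_dist (org s + l) (ctr (run s (e :: es))) (org s + l').
have := nrm_dist (ctr (run s (e :: es))) (ctr (run t (e :: es'))) (org s + l').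
have -> : org s + l - (org s + l') =
    (scl s * rad_next s e) *: (loop (angle s) - loop (angle t)).
  by rewrite opprD addrACA subrr add0r -scalerBr.
rewrite nrmZ (nrmB (_ + l)).
have r1' : 1 <= rad_next s e by apply: le_trans r1 (rad_le_next gs ve).
rewrite ger0_norm; last by rewrite mulr_ge0 // ?(ltW s0) // (le_trans ler01).
move=> h3 h4.
have d0' : (0 : R) < (den s)%:R by rewrite ltr0n.
have shq : 18 * shrink s <= 1 / (den s)%:R.
  have : 36 * (shrink s * (den s)%:R) = win_next s.
    by rewrite /shrink; field; rewrite gt_eqF.
  rewrite ler_pdivlMr //.
  have := win_next_den gs ve; have := win_next_gt0 gs ve => w1.
  have : win_next s * 1 <= win_next s * (den s)%:R by rewrite ler_pM2l // ler1n.
  lra.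
have shs : scl s * (18 * shrink s) <= scl s * (1 / (den s)%:R) by rewrite ler_pM2l.
(* One [1 / den] comes from the hypothesis and at most one from each tiny copy. Distinct numerators
   would give at least [4 / den]. *)
have : scl s * nrm (loop (angle s) - loop (angle t)) <= scl s * (3 / (den s)%:R).
  have : scl s * nrm (loop (angle s) - loop (angle t)) <=
     scl s * rad_next s e * nrm (loop (angle s) - loop (angle t)).
    by rewrite ler_wpM2r ?nrm_ge0 // ler_peMr // ltW.
  have -> : scl s * (3 / (den s)%:R) = 3 * (scl s * (1 / (den s)%:R)) by ring.
  rewrite mul1r in shs *.
  move: h h1 h2 h3 h4 shs; move: (nrm _) (nrm _) (nrm _) (nrm _) (nrm _) => *; lra.
have [_ [_ _]] := gt; rewrite -d => nt.
rewrite ler_pM2l // => /(angle_close st gs gt).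
rewrite -!natrM !ler_nat; move: d0 ns nt; clear.
lia.
Qed.

Lemma nrm_ctr_aligned s t : aligned s t -> good s ->
  nrm (ctr s - ctr t) = scl s * rad s * nrm (loop (angle s) - loop (angle t)).
Proof.
move=> [o sc r w d] [[s0 r1 _ _] _].
rewrite /ctr -o -sc -r opprD addrACA subrr add0r -scalerBr nrmZ ger0_norm //.
by rewrite mulr_ge0 ?(ltW s0) // (le_trans _ r1).
Qed.

Lemma congruence_close s t es es' : aligned s t -> good s -> good t ->
  all (valid_edge A) es -> all (valid_edge A) es' ->
  nrm (ctr (run s es) - ctr (run t es')) <= scl s / (den s)%:R ->
  exists2 k : int, (`|k| <= 8)%N & ((den s)%:Z %| (num s)%:Z + k - (num t)%:Z)%Z.
Proof.
move=> st gs gt ves ves' h.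
have [o sc r w d] := st; have [[s0 r1 w0 _] [_ d0 ns]] := gs.
have := ctr_run gs ves; have := ctr_run gt ves'.
have := err_le gs; have := err_le gt; rewrite -sc -d.
have := err_ge0 (good_run gs ves); have := err_ge0 (good_run gt ves').
have := nrm_dist (ctr s) (ctr (run s es)) (ctr t).
have := nrm_dist (ctr (run s es)) (ctr (run t es')) (ctr t).
rewrite (nrm_ctr_aligned st gs).
rewrite (nrmB (ctr s)) => h1 h2 h3 h4 h5 h6 h7 h8.
(* Here 35 = 1 + 17 + 17, from the hypothesis and the two errors. Since 35 / 4 < 9, the numerators
   differ by at most 8 modulo [den]. *)
have : scl s * nrm (loop (angle s) - loop (angle t)) <= scl s * (35 / (den s)%:R).
  have : scl s * nrm (loop (angle s) - loop (angle t)) <=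
     scl s * rad s * nrm (loop (angle s) - loop (angle t)).
    by rewrite ler_wpM2r ?nrm_ge0 // ler_peMr // ltW.
  have -> : scl s * (35 / (den s)%:R) = 35 * (scl s / (den s)%:R) by ring.
  move: h h1 h2 h3 h4 h5 h6 h7 h8.
  move: (nrm _) (nrm _) (nrm _) (nrm _) (nrm _) => *; lra.
have [_ [_ _]] := gt; rewrite -d => nt.
rewrite ler_pM2l // => /(angle_close st gs gt).
rewrite -!natrM !ler_nat => q.
have {q}[q|q] : (`|(num s)%:Z - (num t)%:Z| <= 8)%N \/
  (den s - `|(num s)%:Z - (num t)%:Z| <= 8)%N by move: q; clear; lia.
  exists ((num t)%:Z - (num s)%:Z); first by move: q; clear; lia.
  by rewrite addrCA subrr addr0 subrr dvdz0.
(* The shorter arc passes through the angle 0, so [k] is corrected by [den] in one direction or the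
   other. *)
have [le|le] := leqP (num t) (num s).
  exists ((den s)%:Z + (num t)%:Z - (num s)%:Z); first by move: q d0 ns nt le; clear; lia.
  have -> : (num s)%:Z + ((den s)%:Z + (num t)%:Z - (num s)%:Z) - (num t)%:Z = (den s)%:Z.
    by ring.
  exact: dvdzz.
exists ((num t)%:Z - (num s)%:Z - (den s)%:Z); first by move: q d0 ns nt le; clear; lia.
have -> : (num s)%:Z + ((num t)%:Z - (num s)%:Z - (den s)%:Z) - (num t)%:Z = - (den s)%:Z.
  by ring.
by rewrite dvdzE abszN dvdnn.
Qed.

(** A carry [k] rotates by [k / den], which moves the centre by at most [16 * |k| / den] times the
    scale. *)
Lemma ctr_congruence s t (k : int) : aligned s t -> good s -> good t ->
  ((den s)%:Z %| (num s)%:Z + k - (num t)%:Z)%Z ->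
  nrm (ctr s - ctr t) <= `|k|%N%:R * err s.
Proof.
move=> st gs gt dv.
have [o sc r w d] := st; have [[s0 r1 w0 rw] [_ d0 ns]] := gs.
have d0' : (0 : R) < (den s)%:R by rewrite ltr0n.
rewrite (nrm_ctr_aligned st gs).
have [up1 up2 _] := loop_dist (angle01 gs) (angle01 gt).
have nl : nrm (loop (angle s) - loop (angle t)) <= 8 * (`|k|%N%:R / (den s)%:R).
  have [_ [_ _]] := gt; rewrite -d => nt.
  move: up1 up2; rewrite (angle_dist st); set q := `|_ - _|%N => up1 up2.
  have [qk|qk] : (q <= `|k|)%N \/ (den s - q <= `|k|)%N.
  (* A zero quotient means no wrap-around; a nonzero one forces the difference of the numerators
     plus [|k|] to reach [den]. *)
  - case/dvdzP: dv => j dj.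
    have [j0|j0] := eqVneq j 0; first by left; rewrite j0 mul0r in dj; rewrite /q; move: dj; clear; lia.
    right; have : (1 <= `|j|)%N by move: j0; clear; lia.
    rewrite -(leq_pmul2r d0) mul1n => dj'.
    have := congr1 absz dj; rewrite abszM absz_nat; move: dj' ns nt; rewrite /q; clear; lia.
  - by apply: (le_trans up1); rewrite ler_pM2l // ler_pM2r ?invr_gt0 // ler_nat.
  - apply: (le_trans up2); rewrite ler_pM2l //.
    have dle : (q <= den s)%N by rewrite /q; move: ns nt; clear; lia.
    have -> : 1 - q%:R / (den s)%:R = (den s - q)%N%:R / (den s)%:R :> R.
      by rewrite natrB // mulrBl divff ?gt_eqF.
    by rewrite ler_pM2r ?invr_gt0 // ler_nat.
rewrite /err mulrCA -mulrA ler_pM2l //.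
have : rad s * nrm (loop (angle s) - loop (angle t)) <=
   2 * nrm (loop (angle s) - loop (angle t)).
  by rewrite ler_wpM2r ?nrm_ge0 //; lra.
have : 0 <= `|k|%N%:R * win s by rewrite mulr_ge0 // ltW.
rewrite (mulrDr _ (win s)); move: nl.
have -> : `|k|%N%:R * (16 / (den s)%:R) = 16 * (`|k|%N%:R / (den s)%:R) :> R by ring.
move: (nrm _) (_ * win s) (_ / _) => *; lra.
Qed.
End Pictures.

(** * The action on left-infinite paths *)

Section Sequences.
Variables (R : realFieldType) (N : nat) (A : 'M[nat]_N) (B : 'M[int]_N).
Variables (code : edge N -> nat) (b : nat).
Hypothesis code_inj : injective code.
Hypothesis code_gt0 : forall e, (0 < code e)%N.
Hypothesis b_code : forall e, valid_edge A e -> ((code e).*2.+1 <= b)%N.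
Hypothesis b_deg : forall e, valid_edge A e -> (A (rg e) (sc e) <= b)%N.
Hypothesis B01 : forall i j, B i j = 0 \/ B i j = 1.

Implicit Types (x y : nat -> edge N).

Definition init_picture : picture R := Picture 0 1 1 1 1 0.
Definition state x n : picture R := run A B code b init_picture (mkseq x n).
(** [ltail x n] is [word x n.+1]; the shift lets inductions start at the empty word. *)
Definition word x n : seq (edge N) := rev (mkseq x n).

Lemma stateS x n : state x n.+1 = step A B code b (state x n) (x n).
Proof. by rewrite /state mkseqS /run foldl_rcons. Qed.

Lemma wordS x n : word x n.+1 = x n :: word x n.
Proof. by rewrite /word mkseqS rev_rcons. Qed.

Definition valid x : Prop := forall n, valid_edge A (x n).

Lemma good_state x n : valid x -> good (state x n).
Proof.
move=> vx; elim: n => [|n IH]; last first.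
  by rewrite stateS; exact: (good_step B code_gt0 b_code b_deg IH (vx n)).
split; split => //=; rewrite ?mulr1 //; lra.
Qed.

(** What the action preserves apart from the current block: at a break no carry survives, so the
    edge and the angle to its right are fixed. *)
Definition matching x y n : Prop := forall j, (j < n)%N ->
  (x j).1 = (y j).1 /\
  (is_break A B (state x j) (x j) -> x j = y j /\ num (state x j) = num (state y j)).

Lemma matchingS x y n : matching x y n.+1 <-> matching x y n /\
  (x n).1 = (y n).1 /\
  (is_break A B (state x n) (x n) -> x n = y n /\ num (state x n) = num (state y n)).
Proof.
split=> [h|[h1 h2] j]; first by split=> [j jn|]; apply: h => //; exact: ltnW.
by rewrite ltnS leq_eqVlt => /predU1P[->|/h1].
Qed.

Lemma matching_aligned x y n : matching x y n -> aligned (state x n) (state y n).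
Proof.
elim: n => [_|n IH /matchingS[/IH al [e br]]]; first by split.
by rewrite !stateS; exact: aligned_step.
Qed.

Lemma num_state_dvd x y n : valid x -> valid y -> aligned (state x n) (state y n) ->
  ((den (state x n))%:Z %| (num (state x n))%:Z - (num (state y n))%:Z)%Z ->
  num (state x n) = num (state y n).
Proof.
move=> vx vy [_ _ _ _ d].
have [_ [_ _ nx]] := good_state n vx; have [_ [_ _]] := good_state n vy.
rewrite -d => ny /dvdzP[q]; move: nx ny.
move: (num _) (num _) (den _) => a c p; clear => ap cp h.
have [q0|q0] := eqVneq q 0; first by move: h; rewrite q0 mul0r; lia.
have : (1 <= `|q|)%N by move: q0; clear; lia.
have p0 : (0 < p)%N by exact: leq_ltn_trans ap.
rewrite -(leq_pmul2r p0) mul1n.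
have := congr1 absz h; rewrite abszM absz_nat => <-; move: ap cp; clear; lia.
Qed.

(* On a block of digits acting by [a_i^k] is adding [k] to the numerator
   modulo the denominator. *)
Lemma act_matching x y n k : valid x -> valid y ->
  (act_path A B k (word x n)).1 = word y n <->
  matching x y n /\
  ((den (state x n))%:Z %| (num (state x n))%:Z + k - (num (state y n))%:Z)%Z.
Proof.
move=> vx vy; elim: n k => [|n IH] k.
  by split=> // _; split=> //=; exact: dvd1z.
have vxn := vx n; have vyn := vy n.
rewrite !wordS /= !stateS matchingS.
set s := state x n; set t := state y n; set e := x n; set e' := y n.
have [_ [dx nx ndx]] := good_state n vx; rewrite -/s in dx nx ndx.
have a0 : (0 < deg A e)%N by exact: leq_ltn_trans vxn.
split.
- move=> [he hp].
  have [sim dv] := (IH _).1 hp; rewrite -/s -/t in dv.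
  have al := matching_aligned sim; rewrite -/s -/t in al.
  have e1 : e.1 = e'.1 by rewrite -he.
  have e2 : e'.2 = `|((k * B (rg e) (sc e) + (e.2)%:Z) %% (A (rg e) (sc e))%:Z)%Z|%N.
    by rewrite -he.
  (* Either [B = 0], so the edge is fixed and the carry becomes 0, or [deg] and [den] are 1, so both
     digits are 0 and the congruence is trivial. *)
  have fin : is_break A B s e -> e = e' /\ num s = num t.
    move=> br; suff [? dv'] : e.2 = e'.2 /\ ((den s)%:Z %| (num s)%:Z - (num t)%:Z)%Z.
      split; last exact: num_state_dvd.
      by rewrite [e]surjective_pairing [e']surjective_pairing; congr pair.
    move: br; rewrite /is_break => /orP[/eqP b0|].
      move: e2 dv; rewrite /act_edge b0 mulr0 add0r /= modz_small; last by [].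
      by rewrite absz_nat => -> ; rewrite divz_small ?addr0.
    rewrite muln_eq1 => /andP[/eqP -> /eqP a1]; split; last exact: dvd1z.
    move: vxn vyn; rewrite /valid_edge -/e -/e'.
    have -> : A (rg e') (sc e') = A (rg e) (sc e) by rewrite /rg /sc e1.
    by rewrite -/(deg A e) a1; case: (e.2) (e'.2) => [|?] [|?].
  split; first by [].
  rewrite /step -(aligned_break A B al e1); case: ifP => br /=; first exact: dvd1z.
  have b1 : B (rg e) (sc e) = 1.
    by case: (B01 (rg e) (sc e)) => // b0; move: br; rewrite /is_break b0 eqxx.
  have -> : deg A e' = deg A e by rewrite /deg /rg /sc e1.
  move: e2 dv; rewrite -/(deg A e) b1 mulr1; set u := k + _; set a := deg A e.
  have := divz_eq u a%:Z; have := modz_ge0 u (d := a%:Z).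
  have an : a%:Z != 0 by move: a0; rewrite -/a; clear; lia.
  move=> /(_ an).
  move: (u %% a)%Z (u %/ a)%Z => r q r0 uq er dv.
  (* With [k + m = q * a + r], the congruence for [k] at the new depth is [a] times the one for the
     carry [q] at the old depth. *)
  have -> : (num s * a + e.2)%N%:Z + k - (num t * a + e'.2)%N%:Z =
            ((num s)%:Z + q - (num t)%:Z) * a%:Z.
    have re : (e'.2)%:Z = r by rewrite er gez0_abs.
    have ku : k = q * a%:Z + r - (e.2)%:Z by rewrite -uq /u addrK.
    by rewrite !PoszD !PoszM re ku; ring.
  by rewrite PoszM dvdz_mul.
- move=> [[sim [e1 fin]]].
  have al := matching_aligned sim; rewrite -/s -/t in al.
  have ae : deg A e' = deg A e by rewrite /deg /rg /sc e1.
  rewrite /step -(aligned_break A B al e1); case: ifP => br /= dv.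
    have [<- nst] := fin br; rewrite /act_edge -/(deg A e).
    suff [h1 h2] : `|((k * B (rg e) (sc e) + (e.2)%:Z) %% (deg A e)%:Z)%Z|%N = e.2 /\
      ((den s)%:Z %| ((k * B (rg e) (sc e) + (e.2)%:Z) %/ (deg A e)%:Z)%Z)%Z.
      rewrite /= h1 -surjective_pairing; congr cons.
      by apply: (IH _).2; split=> //; rewrite -/s -/t nst addrAC subrr add0r.
    move: br; rewrite /is_break => /orP[/eqP b0|].
      by rewrite b0 mulr0 add0r modz_small // divz_small // dvdz0.
    rewrite muln_eq1 => /andP[/eqP -> /eqP a1]; split; last exact: dvd1z.
    by rewrite a1 modz1; move: vxn; rewrite /valid_edge -/e -/(deg A e) a1; case: (e.2).
  have b1 : B (rg e) (sc e) = 1.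
    by case: (B01 (rg e) (sc e)) => // b0; move: br; rewrite /is_break b0 eqxx.
  move: dv; rewrite ae => /dvdzP[j]; rewrite !PoszD !PoszM => hj.
  (* The congruence is solved for quotient and remainder: the factor of [deg] is the carry handed
     on, the remainder is the digit of [y]. *)
  have ku : k * B (rg e) (sc e) + (e.2)%:Z =
     (j * (den s)%:Z - (num s)%:Z + (num t)%:Z) * (deg A e)%:Z + (e'.2)%:Z.
    by rewrite b1 mulr1; move: hj; clear; lia.
  have ve' : (e'.2 < deg A e)%N by rewrite -ae; exact: vyn.
  have an : (deg A e)%:Z != 0 by move: a0; clear; lia.
  rewrite /act_edge -/(deg A e) ku modzMDl divzMDl // modz_small // divz_small // addr0.
  rewrite /= e1 -surjective_pairing; congr cons.
  apply: (IH _).2; split=> //; rewrite -/s -/t.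
  rewrite (_ : _ - _ = j * (den s)%:Z) ?dvdz_mull //; ring.
Qed.
End Sequences.

(** * The limit point *)

(** Every left endpoint lies below every right endpoint, so the supremum of the left ones lies in
    all the intervals. *)
Lemma nested_sup (R : realType) (c e : nat -> R) :
  (forall n, 0 <= e n) ->
  (forall n m, (n <= m)%N -> `|c m - c n| + e m <= e n) ->
  forall n, `|sup [set c m - e m | m in [set: nat]]%classic - c n| <= e n.
Proof.
move=> e0 h n.
have ub m k : c k - e k <= c m + e m.
  case/orP: (leq_total m k) => /h.
    have := e0 k; have := ler_norm (c k - c m); lra.
  have := e0 m; rewrite distrC; have := ler_norm (c k - c m); lra.
rewrite ler_distl; apply/andP; split.
  apply: ub_le_sup; last by exists n.
  by exists (c n + e n) => _ [m _ <-].
apply: ge_sup; first by exists (c n - e n), n.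
by move=> _ [m _ <-].
Qed.

(** * Finite words of a path, and edges with A = B = 1 *)

Section Regularity.
Variables (N : nat) (A : 'M[nat]_N) (B : 'M[int]_N).
Implicit Types (x : nat -> edge N).

Lemma linf_shift x n : linf_path A x -> linf_path A (fun i => x (n + i)%N).
Proof. by move=> px i; have := px (n + i)%N; rewrite addnS. Qed.

Lemma fpath_word x n : linf_path A x -> Defs.fpath A (sc (x n)) (word x n).
Proof.
move=> px; elim: n => [|n IH] //; rewrite wordS /= IH andbT.
by have [-> ->] := px n; rewrite eqxx.
Qed.

Lemma fsource_word x n i : fsource i (word x n.+1) = sc (x 0).
Proof. by elim: n i => [|n IH] i //; rewrite wordS /= IH. Qed.

Lemma act_trivial (p : seq (edge N)) (k : int) :
  all (fun e => [&& B (rg e) (sc e) == 1, deg A e == 1%N & valid_edge A e]) p ->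
  act_path A B k p = (p, k).
Proof.
elim: p => [|e p IH] // /andP[/and3P[/eqP b1 /eqP a1 ve] /IH{}IH].
have eE : act_edge A B k e = (e, k).
  move: ve; rewrite /act_edge /valid_edge -/(deg A e) a1 b1 mulr1 divz1 modz1.
  by case: e {b1 a1} => [? [|?]] //=; rewrite addr0.
by rewrite -[LHS]/((act_edge A B k e).1 :: (act_path A B (act_edge A B k e).2 p).1,
  (act_path A B (act_edge A B k e).2 p).2) eE IH.
Qed.
End Regularity.

Section Limits.
Variables (R : realType) (N : nat) (A : 'M[nat]_N) (B : 'M[int]_N).
Variables (code : edge N -> nat) (b : nat).
Hypothesis code_inj : injective code.
Hypothesis code_gt0 : forall e, (0 < code e)%N.
Hypothesis b_code : forall e, valid_edge A e -> ((code e).*2.+1 <= b)%N.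
Hypothesis b_deg : forall e, valid_edge A e -> (A (rg e) (sc e) <= b)%N.
Hypothesis B01 : forall i j, B i j = 0 \/ B i j = 1.
Hypothesis regAB : regular_KEP A B.

Implicit Types (x y : nat -> edge N).
Local Notation state := (state R A B code b).
Local Notation matching := (matching R A B code b).

Lemma linf_valid x : linf_path A x -> valid A x.
Proof. by move=> px n; have [] := px n. Qed.

Lemma good_linf x n : linf_path A x -> good (state x n).
Proof. by move=> /linf_valid px; exact: good_state. Qed.

(* A long run of edges with [A = B = 1] transports [a_i] unchanged, so by
   regularity [a_j] acts trivially on what lies to its right. *)
Lemma break_or_digit x n : linf_path A x ->
  exists2 m, (n <= m)%N & is_break A B (state x m) (x m) \/ (1 < deg A (x m))%N.
Proof.
move=> px; have vx := linf_valid px.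
(* Regularity is used for the generators [a_i] only; there are finitely many vertices, so one length
   [L] serves all. *)
have [K hK] : exists K : 'I_N -> nat, forall i p, Defs.fpath A i p -> (K i <= size p)%N ->
      (act_path A B 1 p).1 = p -> gequiv A B (fsource i p) (act_path A B 1 p).2 0.
  by apply: (fin_all_exists (fun i => regAB i 1)).
pose L := \max_i K i.
case: (boolP (has (fun m => is_break A B (state x m) (x m) || (1 < deg A (x m))%N)
                  (iota n L.+1))) => [/hasP[m]|/hasPn h].
  by rewrite mem_iota => /andP[nm _] /orP[] ?; exists m => //; [left|right].
have h1 m : (n <= m < n + L.+1)%N ->
    [/\ B (rg (x m)) (sc (x m)) = 1, deg A (x m) = 1%N & den (state x m) != 1%N].
  rewrite -mem_iota => /h; rewrite negb_or /is_break negb_or -leqNgt.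
  have a0 : (0 < deg A (x m))%N by exact: leq_ltn_trans (vx m).
  move=> /andP[/andP[b0 d1] a1].
  have a1' : deg A (x m) = 1%N by apply/eqP; rewrite eqn_leq a1.
  split=> //; last by move: d1; rewrite a1' muln1.
  by case: (B01 (rg (x m)) (sc (x m))) b0 => // ->; rewrite eqxx.
pose x' i := x (n + i)%N; have px' : linf_path A x' := linf_shift n px.
have tr : act_path A B 1 (word x' L.+1) = (word x' L.+1, 1).
  apply: act_trivial; rewrite all_rev all_map; apply/allP => i.
  rewrite mem_iota add0n => /andP[_ iL] /=.
  have [|-> -> _] := h1 (n + i)%N; first by rewrite leq_addr ltn_add2l.
  by rewrite !eqxx; exact: vx.
have := hK (sc (x' L.+1)) (word x' L.+1) (fpath_word L.+1 px').
rewrite tr size_rev size_mkseq => /(_ (leqW (leq_bigmax _)) erefl).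
rewrite fsource_word /x' addn0 => /(_ _ (fpath_word n px)).
have self k := act_matching R code_gt0 b_code b_deg B01 n k vx vx.
have sim : matching x x n by [].
have -> : (act_path A B 0 (word x n)).1 = word x n.
  by apply/(self 0); split=> //; rewrite addr0 subrr dvdz0.
(* With [y = x] and [k = 1] the congruence says that [den] divides 1, against [h1] at [n]. *)
move=> /(self 1)[_]; rewrite addrAC subrr add0r dvdzE dvdn1 absz_nat.
by have [|_ _ /negbTE->] := h1 n; first by rewrite leqnn -addn1 leq_add2l.
Qed.

(** * Decay of the errors *)

Definition size_at x n : R := scl (state x n) / (den (state x n))%:R.

(** A digit divides [size_at] by its degree. A break moves [1 / den] into the scale and contributes
    the factor [win_next / 36]. *)
Lemma size_at_step x n : linf_path A x -> size_at x n.+1 <= size_at x n /\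
  (is_break A B (state x n) (x n) \/ (1 < deg A (x n))%N ->
   size_at x n.+1 <= size_at x n / 2).
Proof.
move=> px; have gs := good_linf n px; have vx := linf_valid px.
have [[s0 _ _ _] [_ d0 _]] := gs.
have q0 : 0 < size_at x n by rewrite divr_gt0 // ltr0n.
have sh := shrink_gt0 code_gt0 b_code gs (vx n).
have wd := win_next_den B code_gt0 b_code gs (vx n).
suff [h1 h2] : (is_break A B (state x n) (x n) -> size_at x n.+1 <= size_at x n / 2) /\
   (~~ is_break A B (state x n) (x n) ->
    size_at x n.+1 = size_at x n / (deg A (x n))%:R).
  case: (boolP (is_break A B (state x n) (x n))) => br.
    by split=> [|_]; [apply: le_trans (h1 br) _; lra|exact: h1].
  rewrite h2 //; have a0 : (0 < deg A (x n))%N by exact: leq_ltn_trans (vx n).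
  split=> [|[]//]; first by rewrite ler_pdivrMr ?ltr0n // ler_peMr ?ler1n // ltW.
  by move=> a2; rewrite ler_pM2l // lef_pV2 ?posrE ?ltr0n // ler_nat.
rewrite /size_at stateS /step; split=> [br|/negbTE br]; rewrite br /=.
  rewrite divr1 -mulrA ler_pM2l // /shrink.
  have d1 : (1 : R) <= (den (state x n))%:R by rewrite ler1n.
  have w1 := win_next_gt0 code_gt0 b_code gs (vx n).
  rewrite invfM mulrA [leRHS]mulrC ler_pM2r ?invr_gt0 ?ltr0n //.
  have : win_next b (state x n) * 1 <= win_next b (state x n) * (den (state x n))%:R.
    by rewrite ler_pM2l.
  lra.
by rewrite natrM invfM mulrA.
Qed.

Lemma size_at_anti x n m : linf_path A x -> (n <= m)%N -> size_at x m <= size_at x n.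
Proof.
move=> px /subnK <-; elim: (m - n)%N => [|l IH] //; rewrite addSn.
exact: le_trans (size_at_step _ px).1 IH.
Qed.

(** [break_or_digit] yields infinitely many halvings of [size_at], and [err] is at most 17 times
    [size_at]. *)
Lemma err_small x (eta : R) : linf_path A x -> 0 < eta ->
  exists M, forall m, (M <= m)%N -> err (state x m) <= eta.
Proof.
move=> px eta0.
have small j : exists n, size_at x n <= (2 ^+ j)^-1.
  elim: j => [|j [n hn]]; first by exists 0%N; rewrite /size_at /= divr1 expr0 invr1.
  have [m nm hm] := break_or_digit n px; exists m.+1.
  apply: le_trans ((size_at_step m px).2 hm) _.
  rewrite exprSr invfM ler_pM2r ?invr_gt0 //.
  exact: le_trans (size_at_anti px nm) hn.
pose j := Num.bound (17 / eta).
have hj : 17 / eta < 2 ^+ j.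
  apply: lt_trans (archi_boundP _) _; first by rewrite divr_ge0 // ltW.
  by rewrite -natrX ltr_nat ltn_expl.
have [M hM] := small j; exists M => m Mm.
apply: le_trans (err_le (good_linf m px)) _; rewrite -/(size_at x m).
have p0 : 0 < 2 ^+ j :> R by rewrite exprn_gt0.
have : 17 * (2 ^+ j)^-1 <= eta by rewrite ler_pdivrMr // mulrC -ler_pdivrMr // ltW.
have := le_trans (size_at_anti px Mm) hM; lra.
Qed.

Lemma state_run x n m : linf_path A x -> (n <= m)%N -> exists2 es,
  all (valid_edge A) es & state x m = run A B code b (state x n) es.
Proof.
move=> px /subnK <-; elim: (m - n)%N => [|l [es ves e]]; first by exists [::].
exists (rcons es (x (l + n)%N)); first by rewrite all_rcons ves andbT; exact: linf_valid.
by rewrite addSn stateS e /run foldl_rcons.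
Qed.

Lemma state_cons x n m : linf_path A x -> (n < m)%N -> exists2 es,
  all (valid_edge A) es & state x m = run A B code b (state x n) (x n :: es).
Proof.
by move=> px /(state_run px)[es ves e]; exists es => //; rewrite e stateS.
Qed.

(** For a path, the point singled out by the nested intervals in each coordinate; a supremum makes
    it total on all sequences. *)
Definition limit x : R^o * R^o :=
  (sup [set (ctr (state x m)).1 - err (state x m) | m in [set: nat]]%classic,
   sup [set (ctr (state x m)).2 - err (state x m) | m in [set: nat]]%classic).

Lemma ctr_nested x n m : linf_path A x -> (n <= m)%N ->
  nrm (ctr (state x m) - ctr (state x n)) + err (state x m) <= err (state x n).
Proof.
move=> px nm; have [es ves ->] := state_run px nm.
exact: (ctr_run B code_gt0 b_code b_deg (good_linf n px) ves).
Qed.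

(** The factor 2 arises because the two coordinates are bounded separately. *)
Lemma limit_ctr x n : linf_path A x ->
  nrm (limit x - ctr (state x n)) <= 2 * err (state x n).
Proof.
move=> px.
have e0 m : 0 <= err (state x m) by exact: err_ge0 (good_linf m px).
have h1 : `|(limit x).1 - (ctr (state x n)).1| <= err (state x n).
  apply: (nested_sup (c := fun m => (ctr (state x m)).1) (e := fun m => err (state x m))) => //.
  move=> k m km; apply: le_trans (ctr_nested px km).
  by rewrite lerD2r /nrm /= lerDl.
have h2 : `|(limit x).2 - (ctr (state x n)).2| <= err (state x n).
  apply: (nested_sup (c := fun m => (ctr (state x m)).2) (e := fun m => err (state x m))) => //.
  move=> k m km; apply: le_trans (ctr_nested px km).
  by rewrite lerD2r /nrm /= lerDr.
rewrite /nrm /=; lra.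
Qed.

(** Equality of limits in a form that speaks of finite prefixes, to which the separation lemmas
    apply. *)
Definition asymptotic x y : Prop := forall eta : R, 0 < eta -> exists M, forall m,
  (M <= m)%N -> nrm (ctr (state x m) - ctr (state y m)) <= eta.

Lemma asymptotic_limit x y : linf_path A x -> linf_path A y -> limit x = limit y ->
  asymptotic x y.
Proof.
move=> px py xy eta eta0.
have [M hM] := err_small px (divr_gt0 eta0 (ltr0n R 4)).
have [M' hM'] := err_small py (divr_gt0 eta0 (ltr0n R 4)).
exists (maxn M M') => m; rewrite geq_max => /andP[/hM h /hM' h'].
have := nrm_dist (ctr (state x m)) (limit x) (ctr (state y m)).
have := limit_ctr m px; have := limit_ctr m py; rewrite -xy (nrmB _ (limit x)).
move: (nrm _) (nrm _) (nrm _) h h' => *; lra.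
Qed.

Lemma asymptotic_far x y n (eta : R) : asymptotic x y -> 0 < eta -> exists2 m,
  (n < m)%N & nrm (ctr (state x m) - ctr (state y m)) <= eta.
Proof.
move=> h /h[M hM]; exists (maxn n.+1 M); first by rewrite leq_maxl.
by apply: hM; rewrite leq_maxr.
Qed.

(** By induction on the depth: long enough continuations come closer than the separation of labels
    at depth [n] and, at a break, of angles. *)
Lemma asymptotic_matching x y n : linf_path A x -> linf_path A y -> asymptotic x y ->
  matching x y n.
Proof.
move=> px py xy; elim: n => [|n sim] //; apply/matchingS; split=> //.
have al := matching_aligned sim.
have gx := good_linf n px; have gy := good_linf n py.
have vx := linf_valid px n; have vy := linf_valid py n.
have [[s0 _ _ _] [_ d0 _]] := gx.
have w1 := win_next_gt0 code_gt0 b_code gx vx.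
have [e1 eb] : (x n).1 = (y n).1 /\ (is_break A B (state x n) (x n) -> x n = y n).
  apply: (label_inj code_inj al).
  (* Half the threshold of [label_close], which asks for a strict inequality. *)
  have q0 : 0 < scl (state x n) * (win_next b (state x n) / 2) / 2.
    by rewrite divr_gt0 // mulr_gt0 // divr_gt0.
  have [m nm h] := asymptotic_far n xy q0.
  have [es ves e] := state_cons px nm; have [es' ves' e'] := state_cons py nm.
  apply: (label_close code_gt0 b_code b_deg al gx gy vx vy ves ves').
  rewrite -e -e'; apply: (le_lt_trans h); lra.
split=> // br; split; first exact: eb.
have q0 : 0 < scl (state x n) / (den (state x n))%:R by rewrite divr_gt0 // ltr0n.
have [m nm h] := asymptotic_far n xy q0.
have [es ves e] := state_cons px nm; have [es' ves' e'] := state_cons py nm.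
rewrite -(eb br) in e'.
apply: (num_close code_gt0 b_code b_deg al gx gy vx ves ves' br).
by rewrite -e -e'.
Qed.

(** The bound 8 does not depend on [n], which makes the set of group elements finite. *)
Lemma asymptotic_congruent x y n : linf_path A x -> linf_path A y -> asymptotic x y ->
  exists2 k : int, (`|k| <= 8)%N &
    (act_path A B k (word x n)).1 = word y n.
Proof.
move=> px py xy; have sim : matching x y n by exact: asymptotic_matching.
have al := matching_aligned sim.
have gx := good_linf n px; have gy := good_linf n py.
have [[s0 _ _ _] [_ d0 _]] := gx.
have q0 : 0 < scl (state x n) / (den (state x n))%:R by rewrite divr_gt0 // ltr0n.
have [m nm h] := asymptotic_far n xy q0.
have [es ves e] := state_run px (ltnW nm); have [es' ves' e'] := state_run py (ltnW nm).
rewrite e e' in h.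
have [k k8 dv] := congruence_close code_gt0 b_code b_deg al gx gy ves ves' h.
exists k => //; apply/(act_matching R code_gt0 b_code b_deg B01); try exact: linf_valid.
by split.
Qed.

Lemma limit_eq_ae x y : linf_path A x -> linf_path A y -> limit x = limit y ->
  ae_equiv A B x y.
Proof.
move=> px py /(asymptotic_limit px py) xy.
have /boolp.choice[k hk] n : exists k : int,
    (`|k| <= 8)%N /\ (act_path A B k (word x n.+1)).1 = word y n.+1.
  by have [k ? ?] := asymptotic_congruent n.+1 px py xy; exists k.
(* All vertices with all exponents from -8 to 8. *)
exists [seq (i, (j : nat)%:Z - 8) | i <- enum 'I_N, j <- iota 0 17].
exists (fun n => (rg (x n), k n)) => n; have [k8 act] := hk n; split=> //.
apply/allpairsP; exists (rg (x n), absz (k n + 8)%R); split.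
- by rewrite mem_enum.
- by rewrite mem_iota [X in (_ <= X < _)%N]/=; move: k8; clear; lia.
- by congr pair; rewrite [RHS]/=; move: k8; clear; lia.
Qed.

(** The exponents in [F] are bounded by some [C], so centres at equal depth differ by at most [C]
    times an error that tends to 0. *)
Lemma ae_limit_eq x y : linf_path A x -> linf_path A y -> ae_equiv A B x y ->
  limit x = limit y.
Proof.
move=> px py [F [g h]].
pose C := (\max_(p <- F) `|p.2|)%N.
have close n : nrm (ctr (state x n.+1) - ctr (state y n.+1)) <= C%:R * err (state x n.+1).
  have [gF _ act] := h n.
  have [sim dv] := (act_matching R code_gt0 b_code b_deg B01 n.+1 (g n).2
    (linf_valid px) (linf_valid py)).1 act.
  apply: le_trans (ctr_congruence (matching_aligned sim) (good_linf _ px) (good_linf _ py) dv) _.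
  rewrite ler_wpM2r ?err_ge0 ?ler_nat //; first exact: good_linf.
  exact: (@leq_bigmax_seq _ F xpredT (fun p : 'I_N * int => `|p.2|%N) (g n) gF isT).
have small eta : 0 < eta -> nrm (limit x - limit y) <= (4 + C%:R) * eta.
  move=> eta0; have [M hM] := err_small px eta0; have [M' hM'] := err_small py eta0.
  pose m := maxn M M'; have /hM hx : (M <= m.+1)%N by rewrite leqW // leq_maxl.
  have /hM' hy : (M' <= m.+1)%N by rewrite leqW // leq_maxr.
  have := limit_ctr m.+1 px; have := limit_ctr m.+1 py.
  have := nrm_dist (limit x) (ctr (state x m.+1)) (limit y).
  have := nrm_dist (ctr (state x m.+1)) (ctr (state y m.+1)) (limit y).
  rewrite (nrmB (ctr (state y _)) (limit y)).
  have : C%:R * err (state x m.+1) <= C%:R * eta by rewrite ler_wpM2l.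
  have := close m; move: (nrm _) (nrm _) (nrm _) (nrm _) (nrm _) => *; lra.
suff: nrm (limit x - limit y) <= 0.
  rewrite /nrm => n0; have /eqP : `|(limit x - limit y).1| + `|(limit x - limit y).2| = 0.
    by apply/eqP; rewrite eq_le n0 addr_ge0.
  rewrite paddr_eq0 // !normr_eq0 !subr_eq0 => /andP[/eqP h1 /eqP h2].
  by rewrite [limit x]surjective_pairing [limit y]surjective_pairing h1 h2.
rewrite leNgt; apply/negP => n0.
have C0 : 0 < 4 + C%:R :> R by rewrite ltr_pwDl.
(* For this [eta] the bound is half the distance itself, which is absurd for a positive distance. *)
have := small (nrm (limit x - limit y) / (4 + C%:R) / 2).
rewrite !divr_gt0 // => /(_ isT).
have -> : (4 + C%:R) * (nrm (limit x - limit y) / (4 + C%:R) / 2) = nrm (limit x - limit y) / 2.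
  by field; rewrite gt_eqF.
by rewrite leNgt => /negP; apply; lra.
Qed.

(** Paths that agree on the first [M] edges share the picture at depth [M], and each limit lies
    within [2 * eta / 5] of its centre. *)
Lemma limit_continuous x (eta : R) : linf_path A x -> 0 < eta -> exists K, forall y,
  linf_path A y -> (forall n, (n < K)%N -> y n = x n) -> nrm (limit y - limit x) < eta.
Proof.
move=> px eta0; have [M hM] := err_small px (divr_gt0 eta0 (ltr0n R 5)).
exists M => y py yx.
have e : state y M = state x M.
  rewrite /state; congr run; apply: (@eq_from_nth _ (x 0)); rewrite !size_mkseq // => i iM.
  by rewrite !nth_mkseq // yx.
have := limit_ctr M px; have := limit_ctr M py; rewrite e.
have := nrm_dist (limit y) (ctr (state x M)) (limit x); rewrite (nrmB (ctr _)).
have := hM M (leqnn _); move: (nrm _) (nrm _) (nrm _) => *; lra.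
Qed.
End Limits.

(** * Coding of the edges and passage to the complex plane *)

Lemma edge_bound N (A : 'M[nat]_N) (code : edge N -> nat) : exists b, forall e,
  valid_edge A e -> ((code e).*2.+1 <= b)%N /\ (A (rg e) (sc e) <= b)%N.
Proof.
(* There are only finitely many valid edges, although the type of edges may be infinite. *)
exists (\max_i \max_j maxn (A i j) (\max_(m < A i j) (code (i, j, m : nat)).*2.+1))%N.
move=> [[i j] m] ve; rewrite /rg /sc /=; split.
  apply: leq_trans (leq_bigmax i); apply: leq_trans (leq_bigmax j).
  rewrite leq_max; apply/orP; right.
  exact: (leq_bigmax (F := fun m : 'I_(A i j) => (code (i, j, m : nat)).*2.+1) (Ordinal ve)).
apply: leq_trans (leq_bigmax i); apply: leq_trans (leq_bigmax j).
by rewrite leq_maxl.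
Qed.

Lemma normc_lt_nrm (z : CC) (eps : Rdefinitions.R) :
  nrm ((complex.Re z, complex.Im z) : Rdefinitions.R^o * Rdefinitions.R^o) < eps ->
  `|z| < (eps%:C)%C.
Proof.
move=> h; rewrite normc_def ltcR; apply: le_lt_trans h; rewrite /nrm /=.
have n0 : 0 <= `|complex.Re z| + `|complex.Im z| by rewrite addr_ge0.
(* The square of the l1 norm exceeds that of the Euclidean norm by a nonnegative cross term. *)
rewrite -[leRHS](ger0_norm n0) -sqrtr_sqr ler_wsqrtr // sqrrD !real_normK ?num_real //.
by rewrite lerD2r lerDl mulrn_wge0 // mulr_ge0.
Qed.

Theorem theorem7p1 (N : nat) (A : 'M[nat]_N) (B : 'M[int]_N) :
  katsura_pair A B ->
  (forall i j, B i j = 0 \/ B i j = 1) ->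
  regular_KEP A B ->
  limit_space_embeds_in_C A B.
Proof.
move=> _ B01 reg.
(* The successor makes every code positive, as the inner margin of the windows requires. *)
pose code (e : edge N) := (pickle e).+1.
have code_inj : injective code by move=> e e' [] /(pcan_inj pickleK).
have code_gt0 e : (0 < code e)%N by [].
have [b hb] := edge_bound A code.
have b_code e (ve : valid_edge A e) := (hb e ve).1.
have b_deg e (ve : valid_edge A e) := (hb e ve).2.
pose l := @limit Rdefinitions.R N A B code b.
exists (fun x => Complex (l x).1 (l x).2); split=> [x px eps eps0|x y px py].
  have [K hK] := limit_continuous code_gt0 b_code b_deg B01 reg px eps0.
  exists K => y py yx; apply: normc_lt_nrm; exact: hK.
split=> [h|/(ae_limit_eq Rdefinitions.R code_gt0 b_code b_deg B01 reg px py)]; last first.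
  by rewrite /l => ->.
have lxy : l x = l y by move: h; case: (l x) (l y) => [? ?] [? ?] /= [-> ->].
exact: limit_eq_ae lxy.
Qed.
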